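(* Let $q>1$ and $0<u<1$ be real numbers and let $k\ge 0$ be an integer. Then, as an identity of power series in $x$ (the right-hand side being expanded in powers of $x$ at $x=0$), \[ \sum_{\lambda:\ \lambda_1'=k} x^{|\lambda|} M_{(u,q)}(\lambda) = \frac{(ux)^k}{|GL(k,q)|}\cdot \frac{\prod_{r=1}^{\infty} \big(1-\frac{u}{q^r}\big)}{\prod_{r=1}^k \big(1-\frac{ux}{q^r}\big)}, \] where the sum is over all partitions $\lambda$ (of all non-negative integers) having exactly $k$ parts.
   Context: A partition $\lambda$ of $n=|\lambda|\ge 0$ is a sequence $\lambda_1\ge\lambda_2\ge\cdots\ge 0$ of integers with $\sum_i\lambda_i=n$; its parts are the nonzero $\lambda_i$. For $i\ge 1$, $m_i(\lambda)$ denotes the number of parts of $\lambda$ equal to $i$, and $\lambda_i'=m_i(\lambda)+m_{i+1}(\lambda)+\cdots$; in particular $\lambda_1'$ is the number of parts of $\lambda$. For real $q>1$ and integer $m\ge 0$, write $|GL(m,q)|=\prod_{i=0}^{m-1}(q^m-q^i)$ (so $|GL(0,q)|=1$); for $q$ a prime power this is the order of the general linear group over the field with $q$ elements. For $q>1$ and $0<u<1$, the measure $M_{(u,q)}$ on the set of all partitions of all non-negative integers is defined by \[ M_{(u,q)}(\lambda) = \Big[\prod_{r=1}^{\infty} \big(1-\tfrac{u}{q^r}\big)\Big] \frac{u^{|\lambda|}}{q^{2 [\sum_{1\le h<i} h\, m_h(\lambda) m_i(\lambda) + \frac{1}{2} \sum_{i\ge 1} (i-1) m_i(\lambda)^2]}\prod_{i\ge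 1} |GL(m_i(\lambda),q)|}. \] *)

(* Defs.v *)
From HB Require Import structures.
From mathcomp Require Import all_boot all_order all_algebra.
From mathcomp Require Import all_classical all_reals all_analysis.

Set Implicit Arguments.
Unset Strict Implicit.
Unset Printing Implicit Defensive.

Import Order.TTheory GRing.Theory Num.Theory.
Import numFieldNormedType.Exports.

Local Open Scope classical_set_scope.
Local Open Scope ring_scope.

Record fps (R : Type) := FPS { fps_coef : nat -> R }.

Section FpsBase.
Variable R : Type.
HB.instance Definition _ := gen_eqMixin (fps R).
HB.instance Definition _ := gen_choiceMixin (fps R).

Lemma fpsP (f g : fps R) : (forall n, fps_coef f n = fps_coef g n) -> f = g.
Proof. by case: f g => [f] [g] /= fg; congr FPS; apply/funext. Qed.
End FpsBase.

Section FpsZmodule.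
Variable R : zmodType.
Implicit Types f g h : fps R.

Definition fps0 : fps R := FPS (fun=> 0).
Definition fps_add f g := FPS (fun n => fps_coef f n + fps_coef g n).
Definition fps_opp f := FPS (fun n => - fps_coef f n).

Fact fps_addA : associative fps_add.
Proof. by move=> f g h; apply: fpsP => n /=; rewrite addrA. Qed.
Fact fps_addC : commutative fps_add.
Proof. by move=> f g; apply: fpsP => n /=; rewrite addrC. Qed.
Fact fps_add0 : left_id fps0 fps_add.
Proof. by move=> f; apply: fpsP => n /=; rewrite add0r. Qed.
Fact fps_addN : left_inverse fps0 fps_opp fps_add.
Proof. by move=> f; apply: fpsP => n /=; rewrite addNr. Qed.

HB.instance Definition _ :=
  GRing.isZmodule.Build (fps R) fps_addA fps_addC fps_add0 fps_addN.

Lemma fps_coef0 n : fps_coef (0 : fps R) n = 0. Proof. by []. Qed.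
Lemma fps_coefD f g n : fps_coef (f + g) n = fps_coef f n + fps_coef g n.
Proof. by []. Qed.
Lemma fps_coefN f n : fps_coef (- f) n = - fps_coef f n. Proof. by []. Qed.
Lemma fps_coefB f g n : fps_coef (f - g) n = fps_coef f n - fps_coef g n.
Proof. by []. Qed.
Lemma fps_coef_sum (I : Type) (r : seq I) (P : pred I) (F : I -> fps R) n :
  fps_coef (\sum_(i <- r | P i) F i) n = \sum_(i <- r | P i) fps_coef (F i) n.
Proof. by elim/big_rec2: _ => //= i x y _ <-. Qed.

(* Sum of a possibly infinite family of power series, taken coefficientwise.
   It is the usual sum when the family is locally finite, i.e. when for each n
   only finitely many members have a nonzero coefficient of degree n; on other
   families the finitely supported [\sum_(i \in D)] takes a default value. *)
Definition fps_sum (I : choiceType) (D : set I) (F : I -> fps R) : fps R :=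
  FPS (fun n => \sum_(i \in D) fps_coef (F i) n).

End FpsZmodule.

Section FpsRing.
Variable R : comNzRingType.
Implicit Types f g h : fps R.

Definition fps1 : fps R := FPS (fun n => (n == 0%N)%:R).
Definition fpsX : fps R := FPS (fun n => (n == 1%N)%:R).
Definition fps_mul f g : fps R :=
  FPS (fun n => \sum_(i < n.+1) fps_coef f i * fps_coef g (n - i)).
Definition fps_scale (a : R) f : fps R := FPS (fun n => a * fps_coef f n).

Let trunc m f : {poly R} := \poly_(i < m.+1) fps_coef f i.

Let coef_trunc m f i : (i <= m)%N -> (trunc m f)`_i = fps_coef f i.
Proof. by move=> im; rewrite coef_poly ltnS im. Qed.

Let coef_truncM m f g i : (i <= m)%N ->
  (trunc m f * trunc m g)`_i = fps_coef (fps_mul f g) i.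
Proof.
move=> im; rewrite coefM; apply: eq_bigr => j _.
rewrite !coef_trunc ?(leq_trans (leq_subr _ _) im)//.
by rewrite (leq_trans _ im)// -ltnS.
Qed.

Fact fps_mulA : associative fps_mul.
Proof.
move=> f g h; apply: fpsP => n.
transitivity ((trunc n f * (trunc n g * trunc n h))`_n).
  rewrite coefM; apply: eq_bigr => j _.
  have jn : (j <= n)%N by rewrite -ltnS.
  by rewrite coef_trunc// coef_truncM ?leq_subr.
rewrite mulrA coefM; apply: eq_bigr => j _.
have jn : (j <= n)%N by rewrite -ltnS.
by rewrite coef_truncM// coef_trunc ?leq_subr.
Qed.

Fact fps_mulC : commutative fps_mul.
Proof.
by move=> f g; apply: fpsP => n; rewrite -!(coef_truncM _ _ (leqnn n)) mulrC.
Qed.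

Fact fps_mul1 : left_id fps1 fps_mul.
Proof.
move=> f; apply: fpsP => n /=; rewrite big_ord_recl /= mul1r subn0 big1 ?addr0//.
by move=> i _; rewrite mul0r.
Qed.

Fact fps_mulDl : left_distributive fps_mul +%R.
Proof.
move=> f g h; apply: fpsP => n /=.
by rewrite -big_split; apply: eq_bigr => i _; rewrite mulrDl.
Qed.

Fact fps1_neq0 : fps1 != 0.
Proof.
by apply/eqP => /(congr1 (fun f => fps_coef f 0)) /= /eqP; rewrite oner_eq0.
Qed.

HB.instance Definition _ := GRing.Zmodule_isComNzRing.Build (fps R)
  fps_mulA fps_mulC fps_mul1 fps_mulDl fps1_neq0.

Fact fps_scaleA a b f : fps_scale a (fps_scale b f) = fps_scale (a * b) f.
Proof. by apply: fpsP => n /=; rewrite mulrA. Qed.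
Fact fps_scale1 : left_id 1 fps_scale.
Proof. by move=> f; apply: fpsP => n /=; rewrite mul1r. Qed.
Fact fps_scaleDr : right_distributive fps_scale +%R.
Proof. by move=> a f g; apply: fpsP => n /=; rewrite mulrDr. Qed.
Fact fps_scaleDl f : {morph fps_scale^~ f : a b / a + b}.
Proof. by move=> a b; apply: fpsP => n /=; rewrite mulrDl. Qed.

HB.instance Definition _ := GRing.Zmodule_isLmodule.Build R (fps R)
  fps_scaleA fps_scale1 fps_scaleDr fps_scaleDl.

Fact fps_scaleAl (a : R) f g : a *: (f * g) = (a *: f) * g.
Proof.
by apply: fpsP => n /=; rewrite mulr_sumr; apply: eq_bigr => i _; rewrite mulrA.
Qed.

HB.instance Definition _ := GRing.Lmodule_isLalgebra.Build R (fps R) fps_scaleAl.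
HB.instance Definition _ := GRing.Lalgebra_isComAlgebra.Build R (fps R).

Lemma fps_coef1 n : fps_coef (1 : fps R) n = (n == 0%N)%:R. Proof. by []. Qed.
Lemma fps_coefX n : fps_coef fpsX n = (n == 1%N)%:R. Proof. by []. Qed.
Lemma fps_coefZ a f n : fps_coef (a *: f) n = a * fps_coef f n.
Proof. by []. Qed.
Lemma fps_coefM f g n :
  fps_coef (f * g) n = \sum_(i < n.+1) fps_coef f i * fps_coef g (n - i).
Proof. by []. Qed.

Lemma fps_coefM0 f g : fps_coef (f * g) 0 = fps_coef f 0 * fps_coef g 0.
Proof. by rewrite fps_coefM big_ord1. Qed.

Lemma fps_coefXn m n : fps_coef (fpsX ^+ m) n = (n == m)%:R.
Proof.
elim: m n => [|m IH] n; first by rewrite expr0.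
rewrite exprS fps_coefM; case: n => [|n]; first by rewrite big_ord1 mul0r.
rewrite !big_ord_recl big1 /= ?addr0; last by move=> i _; rewrite mul0r.
by rewrite mul0r add0r mul1r IH /bump /= subSS subn0 eqSS.
Qed.

Lemma fps_coef_expr_small f m n : fps_coef f 0 = 0 -> (n < m)%N ->
  fps_coef (f ^+ m) n = 0.
Proof.
move=> f0; elim: m n => [//|m IH] n; rewrite ltnS => nm.
rewrite exprS fps_coefM big_ord_recl f0 mul0r add0r big1// => i _.
rewrite /= /bump /= IH ?mulr0// (leq_trans _ nm)//.
by case: i => i /=; case: (n) => // k _; rewrite ltnS subSS leq_subr.
Qed.

End FpsRing.

Arguments fpsX {R}.

Section FpsUnit.
Variable F : fieldType.
Implicit Types f g : fps F.

Definition fps_unit : {pred fps F} := fun f => fps_coef f 0 != 0.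

(* For f_0 <> 0, the geometric expansion f^-1 = f_0^-1 \sum_m (1 - f_0^-1 f)^m;
   the terms with m > n do not contribute to the coefficient of degree n. *)
Definition fps_inv f : fps F :=
  if fps_coef f 0 == 0 then f else
  let a := (fps_coef f 0)^-1 in
  FPS (fun n => a * fps_coef (\sum_(m < n.+1) (1 - a *: f) ^+ m) n).

Fact fps_mulVf : {in fps_unit, left_inverse 1 fps_inv *%R}.
Proof.
move=> f; rewrite unfold_in => f0; rewrite /fps_inv (negbTE f0).
set a := (fps_coef f 0)^-1; set h := 1 - a *: f.
have h0 : fps_coef h 0 = 0.
  by rewrite fps_coefB fps_coef1 fps_coefZ mulVf// subrr.
apply: fpsP => n.
transitivity (fps_coef ((\sum_(m < n.+1) h ^+ m) * (a *: f)) n).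
  rewrite -scalerAr scalerAl !fps_coefM; apply: eq_bigr => i _ /=.
  congr (_ * _ * _); rewrite !fps_coef_sum.
  have lein : (i.+1 <= n.+1)%N by exact: ltn_ord.
  rewrite -(big_mkord xpredT (fun m => fps_coef (h ^+ m) i)).
  rewrite -[RHS](big_mkord xpredT (fun m => fps_coef (h ^+ m) i)).
  rewrite [RHS](big_cat_nat (n := i.+1))//=.
  rewrite [X in _ + X]big1_seq ?addr0// => m.
  by rewrite mem_index_iota => /andP[_ /andP[im _]]; rewrite fps_coef_expr_small.
have -> : a *: f = 1 - h by rewrite /h opprB addrC subrK.
have -> : (\sum_(m < n.+1) h ^+ m) * (1 - h) = 1 - h ^+ n.+1.
  by clearbody h; rewrite -[RHS]opprB subrX1 -mulNr opprB mulrC.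
by rewrite fps_coefB fps_coef_expr_small// subr0.
Qed.

Fact fps_unitPl f g : g * f = 1 -> fps_unit f.
Proof.
move=> /(congr1 (fun h => fps_coef h 0)); rewrite fps_coefM0 fps_coef1 => gf1.
rewrite /fps_unit; apply/eqP => f0; move: gf1; rewrite f0 mulr0 => /esym/eqP.
by rewrite oner_eq0.
Qed.

Fact fps_inv_out : {in [predC fps_unit], fps_inv =1 id}.
Proof. by move=> f; rewrite inE unfold_in negbK /fps_inv => ->. Qed.

HB.instance Definition _ := GRing.ComNzRing_hasMulInverse.Build (fps F)
  fps_mulVf fps_unitPl fps_inv_out.

Lemma fps_unitE f : (f \is a GRing.unit) = (fps_coef f 0 != 0).
Proof. by []. Qed.

End FpsUnit.

(* A partition is encoded by the finite nonincreasing list of its nonzero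
   parts; the trailing zeros of the infinite sequence are dropped. *)
Record intpart := IntPart {
  parts :> seq nat;
  _ : sorted geq parts && (0%N \notin parts) }.

HB.instance Definition _ := [isSub for parts].
HB.instance Definition _ := [Countable of intpart by <:].

Definition weight (l : intpart) : nat := sumn l.

Definition mult (l : intpart) (i : nat) : nat := count_mem i l.

(* As m_i = 0 for i > |l|, the sums and products over all i >= 1 here, in
   [qexponent] and in [Mmeas] are truncated at |l|. *)
Definition conj_part (l : intpart) (i : nat) : nat :=
  (\sum_(i <= j < (weight l).+1) mult l j)%N.

Lemma part_le_weight (l : intpart) i : i \in (l : seq nat) -> (i <= weight l)%N.
Proof.
rewrite /weight; elim: (l : seq nat) => //= j s IH; rewrite inE.
by case/predU1P => [->|/IH js]; rewrite ?leq_addr// (leq_trans js) ?leq_addl.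
Qed.

Lemma part_gt0 (l : intpart) i : i \in (l : seq nat) -> (0 < i)%N.
Proof.
by case: l => s /= /andP[_ s0] si; rewrite lt0n; apply: contraNneq s0 => <-.
Qed.

Lemma mult_large (l : intpart) i : (weight l < i)%N -> mult l i = 0%N.
Proof.
move=> li; apply/count_memPn/negP => /part_le_weight.
by rewrite leqNgt li.
Qed.

Lemma conj_part1 (l : intpart) : conj_part l 1 = size l.
Proof.
have h i : i \in (l : seq nat) -> (0 < i < (weight l).+1)%N.
  by move=> il; rewrite (part_gt0 il) ltnS part_le_weight.
rewrite /conj_part /mult; move: (weight l).+1 h => N.
elim: (parts l) => [|j s IH] h /=; first by rewrite big1.
rewrite big_split /= IH; last by move=> i si; apply: h; rewrite inE si orbT.
rewrite (bigD1_seq j) ?iota_uniq//= ?eqxx; last by rewrite mem_index_iota h ?mem_head.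
by rewrite big1 ?addn0 ?add1n// => i /negbTE; rewrite eq_sym => ->.
Qed.

Lemma finite_weight (n : nat) : finite_set [set l : intpart | weight l = n].
Proof.
pose e (l : intpart) : n.-tuple 'I_n.+1 := [tuple inord (nth 0%N l i) | i < n].
have einj : {in [set l : intpart | weight l = n] &, injective e}.
  move=> l1 l2; rewrite !inE => w1 w2 e12.
  have sz (l : intpart) : weight l = n -> (size l <= n)%N.
    rewrite /weight => <-; have := @part_gt0 l.
    elim: (parts l) => //= j s IH h.
    rewrite -add1n leq_add ?h ?mem_head// IH// => i si.
    by apply: h; rewrite inE si orbT.
  have nle (l : intpart) i : weight l = n -> (nth 0%N l i <= n)%N.
    move=> <-; case: (ltnP i (size l)) => il; last by rewrite nth_default.
    exact/part_le_weight/mem_nth.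
  have nth12 i : nth 0%N l1 i = nth 0%N l2 i.
    case: (ltnP i n) => ni; last by rewrite !nth_default// (leq_trans _ ni)// sz.
    have := congr1 (fun t => nat_of_ord (tnth t (Ordinal ni))) e12.
    by rewrite !tnth_mktuple /= !inordK// ltnS nle.
  have size_le (a b : intpart) :
      (forall i, nth 0%N a i = nth 0%N b i) -> (size a <= size b)%N.
    move=> ab; rewrite leqNgt; apply/negP => ba.
    by have := part_gt0 (mem_nth 0%N ba); rewrite ab nth_default.
  apply/val_inj/(@eq_from_nth _ 0%N) => [|i _]; last exact: nth12.
  by apply/eqP; rewrite eqn_leq !size_le// => i; rewrite nth12.
by rewrite -(eq_finite_set (inj_card_eq einj)); exact: finite_finset.
Qed.

Definition glorder (R : realType) (m : nat) (q : R) : R :=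
  \prod_(0 <= i < m) (q ^+ m - q ^+ i).

Definition infprod (R : realType) (u q : R) : R :=
  limn (fun n => \prod_(1 <= r < n.+1) (1 - u / q ^+ r)).

Lemma infprod_cvg (R : realType) (u q : R) : 1 < q -> 0 < u -> u < 1 ->
  cvgn (fun n => \prod_(1 <= r < n.+1) (1 - u / q ^+ r)).
Proof.
move=> q1 u0 u1.
have q0 : 0 < q by rewrite (lt_trans _ q1).
have f0 r : 0 <= 1 - u / q ^+ r.
  rewrite subr_ge0 ler_pdivrMr ?exprn_gt0// mul1r.
  by rewrite (le_trans (ltW u1))// exprn_ege1// ltW.
have f1 r : 1 - u / q ^+ r <= 1.
  by rewrite gerBl divr_ge0 ?ltW// exprn_gt0.
have p0 n : 0 <= \prod_(1 <= r < n.+1) (1 - u / q ^+ r) by exact: prodr_ge0.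
apply: nonincreasing_is_cvgn.
  apply/nonincreasing_seqP => n.
  by rewrite big_nat_recr//= ler_piMr.
by exists 0 => _ [n _ <-].
Qed.

(* The factor 2 has been distributed over the bracket in the exponent of q, so
   that 2 * (1/2) cancels and the exponent is a natural number. *)
Definition qexponent (l : intpart) : nat :=
  (2 * (\sum_(1 <= i < (weight l).+1) \sum_(1 <= h < i) h * mult l h * mult l i)
   + \sum_(1 <= i < (weight l).+1) (i - 1) * mult l i ^ 2)%N.

Definition Mmeas (R : realType) (u q : R) (l : intpart) : R :=
  infprod u q *
  (u ^+ weight l /
   (q ^+ qexponent l * \prod_(1 <= i < (weight l).+1) glorder (mult l i) q)).

Lemma Mmeas_locally_finite (R : realType) (u q : R) (D : set intpart) (n : nat) :
  finite_set (D `&` (fun l => fps_coef (Mmeas u q l *: fpsX ^+ weight l) n)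
                @^-1` [set~ 0]).
Proof.
apply: sub_finite_set (finite_weight n) => l [_ /=].
rewrite fps_coefXn; case: eqP => [<-//|_].
by rewrite mulr0.
Qed.

(* Main.v *)
(* Deleting the first column maps partitions with k parts bijectively to partitions
   with j <= k parts, so the generating function F_k of partitions with k parts,
   at X = u x and p = 1/q, satisfies
     F_k = X^k \sum_(j <= k) p^(k^2) / (p; p)_(k-j) F_j,
   which for k > 0 determines the coefficient of degree n of F_k from those of
   degree n - k. By the Durfee rectangle identity
     \sum_(j <= k) [k choose j]_p p^(j^2) X^j / (Xp; p)_j = 1 / (Xp; p)_k
   the claimed product formula satisfies the same recursion. *)

Require Import Defs.
From HB Require Import structures.
From mathcomp Require Import all_boot all_order all_algebra.
From mathcomp Require Import all_classical all_reals all_analysis.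
From mathcomp Require Import zify ring.

Set Implicit Arguments.
Unset Strict Implicit.
Unset Printing Implicit Defensive.

Import Order.TTheory GRing.Theory Num.Theory.
Import numFieldNormedType.Exports.

Local Open Scope classical_set_scope.
Local Open Scope ring_scope.

(** * Gaussian binomial coefficients *)

Section GaussianBinomial.
Variables (R : comNzRingType) (p : R).

Fixpoint gauss_bin (n j : nat) : R :=
  match n, j with
  | _, 0%N => 1
  | 0%N, _.+1 => 0
  | n'.+1, j'.+1 => gauss_bin n' j'.+1 + p ^+ (n' - j') * gauss_bin n' j'
  end.

Lemma gauss_bin0 n : gauss_bin n 0 = 1. Proof. by case: n. Qed.

Lemma gauss_binS n j :
  gauss_bin n.+1 j.+1 = gauss_bin n j.+1 + p ^+ (n - j) * gauss_bin n j.
Proof. by []. Qed.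

Lemma gauss_bin_small n j : (n < j)%N -> gauss_bin n j = 0.
Proof.
elim: n j => [|n IH] [|j]//; rewrite ltnS => nj.
by rewrite gauss_binS !IH ?mulr0 ?addr0// ltnW.
Qed.

Definition qpoch (n : nat) : R := \prod_(1 <= r < n.+1) (1 - p ^+ r).

Lemma qpochS n : qpoch n.+1 = qpoch n * (1 - p ^+ n.+1).
Proof. by rewrite /qpoch big_nat_recr. Qed.

(** Induction on [i + j], since the two terms of the q-Pascal rule lower [i] and [j] respectively;
    they recombine by (1 - p^(i+1)) + p^(i+1) (1 - p^(j+1)) = 1 - p^(i+j+2). *)
Lemma gauss_bin_qpoch i j :
  gauss_bin (i + j) j * (qpoch i * qpoch j) = qpoch (i + j).
Proof.
have poch0 : qpoch 0 = 1 by rewrite /qpoch big_nil.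
have [m] := ubnP (i + j); elim: m => // m IH in i j *; rewrite ltnS => ijm.
case: j ijm => [|j]; first by rewrite addn0 gauss_bin0 poch0 mul1r mulr1.
case: i => [|i] ijm.
  have := IH 0%N j ijm; rewrite !add0n poch0 !mul1r => E.
  rewrite gauss_binS gauss_bin_small// add0r subnn expr0 mul1r.
  by rewrite qpochS mulrA E.
have E1 := IH i j.+1 ltac:(lia); have E2 := IH i.+1 j ltac:(lia).
rewrite addSn gauss_binS (_ : (i + j.+1 - j = i.+1)%N); last by lia.
rewrite [RHS]qpochS -addSn mulrDl.
have -> : gauss_bin (i + j.+1) j.+1 * (qpoch i.+1 * qpoch j.+1) =
    qpoch (i + j.+1) * (1 - p ^+ i.+1).
  by rewrite -E1 (qpochS i); ring.
have -> : p ^+ i.+1 * gauss_bin (i + j.+1) j * (qpoch i.+1 * qpoch j.+1) =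
    qpoch (i + j.+1) * (p ^+ i.+1 * (1 - p ^+ j.+1)).
  by rewrite -addSnnS -E2 (qpochS j); ring.
by rewrite -mulrDr exprD; congr (_ * _); ring.
Qed.

End GaussianBinomial.

(** * The Durfee rectangle identity *)

Section QPochhammerSeries.
Variables (R : comNzRingType) (A : comUnitAlgType R) (p : R).

(** This is (xp; p)_n. *)
Definition qpoch_alg (x : A) (n : nat) : A := \prod_(1 <= r < n.+1) (1 - p ^+ r *: x).

Lemma qpoch_algS x n : qpoch_alg x n.+1 = qpoch_alg x n * (1 - p ^+ n.+1 *: x).
Proof. by rewrite /qpoch_alg big_nat_recr. Qed.

Lemma qpoch_algSl x n : qpoch_alg x n.+1 = (1 - p *: x) * qpoch_alg (p *: x) n.
Proof.
rewrite /qpoch_alg big_ltn// expr1 big_add1 /=; congr (_ * _).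
by apply: eq_bigr => r _; rewrite scalerA -exprSr.
Qed.

Lemma qpoch_alg_unit x n : (forall r, (0 < r)%N -> 1 - p ^+ r *: x \is a GRing.unit) ->
  qpoch_alg x n \is a GRing.unit.
Proof.
move=> xU; rewrite /qpoch_alg big_nat; elim/big_ind: _ => [|y z yU zU|i /andP[i0 _]].
- exact: unitr1.
- by rewrite unitrM yU.
- exact: xU.
Qed.

(* The Durfee rectangle identity; the q-Pascal rule reduces the case k + 1 at x
   to the case k at x and at p x. *)
Lemma sum_gauss_bin_qpoch_alg x k :
  (forall r, (0 < r)%N -> 1 - p ^+ r *: x \is a GRing.unit) ->
  \sum_(j < k.+1) (gauss_bin p k j * p ^+ (j ^ 2)) *: (x ^+ j / qpoch_alg x j) =
  (qpoch_alg x k)^-1.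
Proof.
elim: k x => [|k IH] x xU.
  by rewrite big_ord1 /= /qpoch_alg big_nil expr0 !mul1r scale1r.
have pxU r : (0 < r)%N -> 1 - p ^+ r *: (p *: x) \is a GRing.unit.
  by rewrite scalerA -exprSr => _; exact: xU.
have x1U : 1 - p *: x \is a GRing.unit by have := xU 1%N; rewrite expr1; apply.
have PU n : qpoch_alg x n \is a GRing.unit by exact: qpoch_alg_unit.
have P1U n : qpoch_alg (p *: x) n \is a GRing.unit by exact: qpoch_alg_unit.
pose t j : A := (gauss_bin p k j * p ^+ (j ^ 2)) *: (x ^+ j / qpoch_alg x j).
rewrite big_ord_recl /=.
transitivity (\sum_(j < k.+2) t j + (p ^+ k.+1 *: x) / (1 - p *: x) *
   \sum_(j < k.+1) (gauss_bin p k j * p ^+ (j ^ 2)) *: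
      ((p *: x) ^+ j / qpoch_alg (p *: x) j)).
  rewrite [in RHS]big_ord_recl -[RHS]addrA; congr (_ + _); first by rewrite /t gauss_bin0.
  rewrite mulr_sumr -big_split; apply: eq_bigr => -[j /= jk] _.
  rewrite /t /bump /= !add1n mulrDl scalerDl; congr (_ + _).
  rewrite qpoch_algSl invrM// exprZn -!(scalerAl, scalerAr) !scalerA.
  rewrite [x ^+ j.+1]exprS; congr (_ *: _); last first.
    by rewrite [_^-1 * (1 - _)^-1]mulrC; ring.
  rewrite [X in X = _](_ : _ =
    gauss_bin p k j * (p ^+ (k - j) * p ^+ (j.+1 ^ 2))); last by ring.
  rewrite [X in _ = X](_ : _ =
    gauss_bin p k j * (p ^+ k.+1 * p ^+ (j ^ 2) * p ^+ j)); last by ring.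
  by rewrite -!exprD; congr (_ * _ ^+ _); nia.
rewrite big_ord_recr /= {2}/t gauss_bin_small// mul0r scale0r addr0.
rewrite !IH// -mulrA -invrM// [qpoch_alg _ k * _]mulrC -qpoch_algSl.
(* With P_n = (xp; p)_n there remains 1/P_k + p^(k+1) x / P_(k+1) = 1/P_(k+1), a consequence of
   P_(k+1) = P_k (1 - p^(k+1) x). *)
apply: (mulIr (PU k.+1)); rewrite mulVr// mulrDl -mulrA mulVr// mulr1.
by rewrite qpoch_algS mulrA mulVr// mul1r subrK.
Qed.

End QPochhammerSeries.

(** * The exponent of q in terms of multiplicities *)

Lemma big_nat_eq_idx (T : Type) (idx : T) (op : Monoid.law idx) (f : nat -> T) a m n :
  (a <= m <= n)%N -> (forall i, (m <= i)%N -> f i = idx) ->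
  \big[op/idx]_(a <= i < m) f i = \big[op/idx]_(a <= i < n) f i.
Proof.
move=> /andP[am mn] f1; rewrite [RHS](big_cat_nat (n := m))//=.
rewrite [X in op _ X]big1_seq ?Monoid.mulm1// => i.
by rewrite mem_index_iota => /andP[_ /andP[mi _]]; exact: f1.
Qed.

Section MultiplicityStatistics.
Implicit Type m : nat -> nat.

(** The truncation bound is decoupled from the partition to permit induction on [N]. *)
Definition qexp m N : nat :=
  (2 * (\sum_(1 <= i < N.+1) \sum_(1 <= h < i) h * m h * m i)
   + \sum_(1 <= i < N.+1) (i - 1) * m i ^ 2)%N.

Lemma qexpS m N : qexp m N.+1 =
  (qexp m N + 2 * (\sum_(1 <= h < N.+1) h * m h) * m N.+1 + N * m N.+1 ^ 2)%N.
Proof.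
rewrite /qexp !(big_nat_recr N.+1)//= subn1 /= -big_distrl /=.
by lia.
Qed.

(** The exponent is the sum of the squared column lengths minus the sum of the squared
    multiplicities. With s the sum of the [m i], a new first column of length a + s creating a parts
    equal to 1 therefore adds (a + s)^2 - a^2. *)
Lemma qexp_shift m m' a N : m' 1%N = a ->
  (forall i, (0 < i)%N -> m' i.+1 = m i) ->
  (qexp m' N.+1 = qexp m N + 2 * a * (\sum_(1 <= i < N.+1) m i)
                  + (\sum_(1 <= i < N.+1) m i) ^ 2)%N.
Proof.
move=> m'1 m'S; elim: N => [|N IH].
  by rewrite /qexp !big_nat1 !big_geq ?subnn ?mul0n ?muln0.
have -> : qexp m' N.+2 = (qexp m' N.+1 +
    2 * (\sum_(1 <= h < N.+2) h * m' h) * m N.+1 + N.+1 * m N.+1 ^ 2)%N.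
  by rewrite qexpS m'S.
have -> : (\sum_(1 <= h < N.+2) h * m' h =
    a + \sum_(1 <= h < N.+1) h * m h + \sum_(1 <= h < N.+1) m h)%N.
  rewrite big_ltn// mul1n m'1 -addnA -big_split big_add1 /=; congr (_ + _)%N.
  by apply: eq_big_nat => i /andP[i0 _]; rewrite m'S// mulSn addnC.
rewrite IH (qexpS m) (big_nat_recr N.+1)//=.
move: (\sum_(1 <= h < N.+1) m h)%N (\sum_(1 <= h < N.+1) h * m h)%N (qexp m N) => s t Q.
move: (m N.+1) => c; rewrite -!mulnn; nia.
Qed.

End MultiplicityStatistics.

Lemma qexponentE (l : intpart) N : (weight l <= N)%N ->
  qexponent l = qexp (mult l) N.
Proof.
move=> lN; rewrite /qexponent /qexp; congr (2 * _ + _)%N.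
- apply: big_nat_eq_idx => // i li; rewrite big1// => h _.
  by rewrite (mult_large li) muln0.
- by apply: big_nat_eq_idx => // i li; rewrite (mult_large li) muln0.
Qed.

Lemma sum_mult (l : intpart) N : (weight l <= N)%N ->
  (\sum_(1 <= i < N.+1) mult l i)%N = size l.
Proof.
move=> lN; rewrite -conj_part1; apply/esym/big_nat_eq_idx => // i.
exact: mult_large.
Qed.

Lemma glorder0 (R : realType) (q : R) : glorder 0 q = 1.
Proof. by rewrite /glorder big_nil. Qed.

Lemma prod_glorderE (R : realType) (q : R) (l : intpart) N : (weight l <= N)%N ->
  \prod_(1 <= i < (weight l).+1) glorder (mult l i) q =
  \prod_(1 <= i < N.+1) glorder (mult l i) q.
Proof.
move=> lN; apply: big_nat_eq_idx => // i li.
by rewrite (mult_large li) glorder0.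
Qed.

(** * Adding and deleting the first column *)

Section FirstColumn.
Local Open Scope nat_scope.

Definition add_column_seq k (s : seq nat) : seq nat :=
  map succn s ++ nseq (k - size s) 1.

Fact add_column_subproof k (l : intpart) :
  sorted geq (add_column_seq k l) && (0 \notin add_column_seq k l).
Proof.
case: l => s /= /andP[ss _]; rewrite /add_column_seq mem_cat negb_or mem_nseq andbF andbT.
apply/andP; split; last by elim: s {ss}.
elim: s (k - size s) ss => [|x s IH] a /=; first by elim: a => //= -[|a].
move=> xs; have /(IH a) := path_sorted xs.
case: s {IH} xs => [|y s] /=; last by rewrite {1}/geq /= ltnS => /andP[->].
by move=> _ /=; case: a => //= a ->.
Qed.

Definition add_column k (l : intpart) : intpart :=
  IntPart (add_column_subproof k l).

Definition del_column_seq (s : seq nat) : seq nat :=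
  [seq x <- map predn s | 0 < x].

Fact del_column_subproof (l : intpart) :
  sorted geq (del_column_seq l) && (0 \notin del_column_seq l).
Proof.
case: l => s /= /andP[ss _]; rewrite mem_filter ltnn /= andbT.
apply: sorted_filter; first by move=> x y z /= /[swap]; exact: leq_trans.
by rewrite sorted_map; apply: sub_sorted ss => x y /=; lia.
Qed.

Definition del_column (l : intpart) : intpart := IntPart (del_column_subproof l).

Lemma size_add_column k (l : intpart) : size l <= k -> size (add_column k l) = k.
Proof. by move=> lk; rewrite /= size_cat size_map size_nseq subnKC. Qed.

Lemma weight_add_column k (l : intpart) : size l <= k ->
  weight (add_column k l) = k + weight l.
Proof.
move=> lk; rewrite /weight /= sumn_cat sumn_nseq mul1n -[in RHS](subnK lk).
have -> : sumn (map succn l) = size l + sumn l.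
  by elim: (parts l) => //= x s ->; lia.
by lia.
Qed.

Lemma mult_add_column1 k (l : intpart) : mult (add_column k l) 1 = k - size l.
Proof.
rewrite /mult /= count_cat count_nseq /= mul1n count_map.
rewrite (eq_in_count (a2 := pred0)) ?count_pred0// => i il /=.
by have := Defs.part_gt0 il; lia.
Qed.

Lemma mult_add_columnS k (l : intpart) i : 0 < i ->
  mult (add_column k l) i.+1 = mult l i.
Proof.
move=> i0; rewrite /mult /= count_cat count_nseq count_map /=.
have -> : (1 == i.+1) = false by lia.
by rewrite mul0n addn0.
Qed.

Lemma size_del_column (l : intpart) : size (del_column l) <= size l.
Proof. by rewrite /= size_filter -(size_map predn) count_size. Qed.

(** No bound on [size l] is required: the padding ones become zeros and are filtered out, while the
    original parts are positive and survive. *)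
Lemma add_columnK k : cancel (add_column k) del_column.
Proof.
move=> l; apply: val_inj; rewrite /= /del_column_seq map_cat filter_cat.
rewrite map_nseq filter_nseq cats0 -map_comp map_id_in//.
by apply/all_filterP/allP => i /Defs.part_gt0.
Qed.

Lemma del_columnK (l : intpart) : add_column (size l) (del_column l) = l.
Proof.
apply: val_inj; rewrite /= /add_column_seq /del_column_seq.
case: l => s /= /andP[ss s0].
elim: s ss s0 => //= x s IH xs; rewrite inE negb_or => /andP[x0 s0].
have {}IH := IH (path_sorted xs) s0.
case: ltnP => x1 /=; first by rewrite subSS IH; congr (_ :: _); lia.
(* A head equal to 1 forces the whole tail to consist of ones; deletion then leaves the empty list
   and padding restores every part. *)
have xE : x = 1 by lia.
rewrite {}xE in xs *.
have s1 i : i \in s -> i = 1.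
  move=> si; have : i != 0 by apply: contraNneq s0 => <-.
  have geq_trans : transitive geq by move=> a b c /= /[swap]; exact: leq_trans.
  have /allP/(_ i si) := order_path_min geq_trans xs.
  by rewrite /=; lia.
have d0 : [seq i <- [seq i.-1 | i <- s] | 0 < i] = [::].
  by rewrite (eq_in_filter (a2 := pred0)) ?filter_pred0// => _ /mapP[i /s1-> ->].
by move: IH; rewrite d0 /= !subn0 /= => ->.
Qed.

End FirstColumn.

Lemma add_column_bij k n : set_bij
  [set l : intpart | (size l <= k)%N /\ (k + weight l = n)%N]
  [set l : intpart | size l = k /\ weight l = n] (add_column k).
Proof.
split.
- move=> l [lk ln] /=; rewrite -[LHS]/(size (add_column k l)).
  by rewrite size_add_column ?weight_add_column.
- by move=> l1 l2 _ _; exact: (can_inj (add_columnK k)).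
- move=> l [lk ln]; exists (del_column l); last by rewrite -lk del_columnK.
  split; first by rewrite -lk size_del_column.
  by rewrite -ln -weight_add_column -lk ?size_del_column// del_columnK.
Qed.

(** Induction on [k] splits off the partitions with exactly k + 1 parts; fixing the weight keeps all
    index sets finite, as additivity of [\sum_(l \in _)] requires. *)
Lemma fsum_size_le (V : nmodType) (f : intpart -> V) k n :
  \sum_(l \in [set l : intpart | (size l <= k)%N /\ weight l = n]) f l =
  \sum_(j < k.+1) \sum_(l \in [set l : intpart | size l = j /\ weight l = n]) f l.
Proof.
have fin (P : intpart -> Prop) : finite_set [set l : intpart | P l /\ weight l = n].
  by apply: sub_finite_set (finite_weight n) => l [].
elim: k => [|k IH].
  rewrite big_ord1; apply: eq_fsbigl; apply/seteqP; split=> l /= [].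
    by rewrite leqn0 => /eqP.
  by move=> ->.
rewrite big_ord_recr /= -IH -fsbigU0//.
- apply: eq_fsbigl; apply/seteqP; split=> l /=.
    by rewrite leq_eqVlt => -[/predU1P[|]]; [right|left].
  by move=> [[lk ->]|[-> ->]]//; split=> //; exact: leqW.
- by move=> l /= [[lk _] [lk1 _]]; rewrite lk1 ltnn in lk.
Qed.

(** * Weights of partitions and the recursion of their generating functions *)

Section LocalWeights.
Variables (R : realType) (u q : R).
Hypothesis q1 : 1 < q.

Let q_neq0 : q != 0. Proof. by rewrite gt_eqF// (lt_trans _ q1). Qed.

(** Reverse the product and extract q^m from each of the m factors. *)
Lemma glorder_qpoch m : glorder m q = q ^+ (m ^ 2) * qpoch q^-1 m.
Proof.
rewrite /glorder /qpoch big_nat_rev big_add1 /= -mulnn exprM.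
rewrite -[X in X * _](_ : \prod_(0 <= i < m) q ^+ m = _); last first.
  by rewrite prodr_const_nat subn0.
rewrite -big_split /=; apply: eq_big_nat => i /andP[_ im].
rewrite mulrBr mulr1 add0n exprVn; congr (_ - _).
by rewrite -expfB_cond ?(negPf q_neq0)//.
Qed.

Lemma qpoch_neq0 m : qpoch q^-1 m != 0.
Proof.
rewrite /qpoch big_nat prodf_seq_neq0; apply/allP => r _; apply/implyP => /andP[r0 _].
rewrite subr_eq0 gt_eqF// exprVn invf_lt1 ?exprn_gt0 ?(lt_trans _ q1)//.
by rewrite exprn_egt1// -lt0n.
Qed.

(** This translates the coefficients of the Durfee identity at p = 1/q into the factors
    [column_weight]. *)
Lemma glorderD i j : glorder (i + j) q * (gauss_bin q^-1 (i + j) j * q^-1 ^+ (j ^ 2))^-1 =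
  q ^+ (2 * i * j + j ^ 2) * glorder i q * glorder j q.
Proof.
have g0 : gauss_bin q^-1 (i + j) j != 0.
  apply: contraNneq (qpoch_neq0 (i + j)) => g0.
  by rewrite -gauss_bin_qpoch g0 mul0r.
rewrite !glorder_qpoch -gauss_bin_qpoch invfM exprVn invrK.
rewrite [LHS](_ : _ = q ^+ ((i + j) ^ 2) * q ^+ (j ^ 2) *
  (qpoch q^-1 i * qpoch q^-1 j)); last by field.
rewrite [RHS](_ : _ = q ^+ (2 * i * j + j ^ 2) * q ^+ (i ^ 2) * q ^+ (j ^ 2) *
  (qpoch q^-1 i * qpoch q^-1 j)); last by ring.
by rewrite -!exprD; congr (_ ^+ _ * _); lia.
Qed.

(** [Mmeas] without the infinite product, which is independent of [l]. *)
Definition part_weight (l : intpart) : R :=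
  u ^+ weight l /
   (q ^+ qexponent l * \prod_(1 <= i < (weight l).+1) glorder (mult l i) q).

(** Up to u^k, the factor gained when a partition with j parts receives a first column of length k:
    k - j parts equal to 1 appear, and the power of q comes from [qexp_shift] with a = k - j and s =
    j. *)
Definition column_weight k j : R :=
  (q ^+ (2 * (k - j) * j + j ^ 2) * glorder (k - j) q)^-1.

Lemma part_weight_add_column k (l : intpart) : (size l <= k)%N ->
  part_weight (add_column k l) =
  u ^+ k * (column_weight k (size l) * part_weight l).
Proof.
move=> lk; pose N := (k + weight l)%N.
have lN : (weight l <= N)%N by rewrite leq_addl.
have mN : (weight (add_column k l) <= N.+1)%N by rewrite weight_add_column.
rewrite /part_weight /column_weight (qexponentE mN) (qexponentE lN).
rewrite (prod_glorderE q mN) (prod_glorderE q lN).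
rewrite (qexp_shift _ (mult_add_column1 k l) (@mult_add_columnS k l)).
rewrite (sum_mult lN) weight_add_column// big_ltn// big_add1 /= mult_add_column1.
rewrite (eq_big_nat _ _ (F2 := fun i => glorder (mult l i) q)); last first.
  by move=> i /andP[i0 _]; rewrite mult_add_columnS.
by rewrite -addnA !exprD !invfM; ring.
Qed.

(** The claimed product formula without the infinite product; [fsum_part_weight] shows that it is
    the generating function. *)
Definition part_gf k : fps R :=
  (glorder k q)^-1 *: ((u *: fpsX) ^+ k / qpoch_alg q^-1 (u *: fpsX) k).

Lemma qpoch_factor_unit r : 1 - q^-1 ^+ r *: (u *: fpsX : fps R) \is a GRing.unit.
Proof.
by rewrite fps_unitE fps_coefB !fps_coefZ fps_coefX fps_coef1 !mulr0 subr0 oner_eq0.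
Qed.

(** The Durfee identity at X = u x, multiplied by X^k / |GL(k,q)|; [glorderD] matches the
    coefficients. *)
Lemma part_gf_rec k :
  part_gf k = (u *: fpsX) ^+ k * \sum_(j < k.+1) column_weight k j *: part_gf j.
Proof.
rewrite {1}/part_gf -sum_gauss_bin_qpoch_alg; last first.
  by move=> r _; exact: qpoch_factor_unit.
rewrite scalerAr scaler_sumr; congr (_ * _); apply: eq_bigr => -[j /=].
rewrite ltnS => jk _; rewrite /part_gf !scalerA; congr (_ *: _).
have := glorderD (k - j) j; rewrite subnK// => E.
by rewrite /column_weight -invfM -E invfM invrK.
Qed.

Lemma coef_fpsXnM k (f : fps R) n :
  fps_coef ((u *: fpsX) ^+ k * f) n =
  if (k <= n)%N then u ^+ k * fps_coef f (n - k) else 0.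
Proof.
rewrite exprZn -scalerAl fps_coefZ fps_coefM.
case: leqP => kn.
  rewrite (bigD1 (Ordinal (_ : k < n.+1)%N)) //= fps_coefXn eqxx mul1r big1 ?addr0//.
  move=> i /eqP ik; rewrite fps_coefXn; case: eqP => [e|_]; rewrite ?mul0r//.
  by case: ik; exact: val_inj.
rewrite big1 ?mulr0// => i _; rewrite fps_coefXn.
have := ltn_ord i; case: eqP => [->|]; last by rewrite mul0r.
by rewrite ltnS leqNgt kn.
Qed.

Lemma fsum_part_weight0 n :
  \sum_(l \in [set l : intpart | size l = 0%N /\ weight l = n]) part_weight l =
  fps_coef (part_gf 0) n.
Proof.
pose nil : intpart := @IntPart [::] isT.
have -> : part_gf 0 = 1.
  by rewrite /part_gf /qpoch_alg big_nil expr0 glorder0 divr1 invr1 scale1r.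
rewrite fps_coef1; case: eqVneq => [->|n0].
  rewrite (_ : [set l | _] = [set nil]).
    rewrite fsbig_set1 /part_weight /qexponent /= !big_geq// !muln0 addn0.
    by rewrite !expr0 mulr1 divr1.
  apply/seteqP; split=> l /= => [[/size0nil l0 _]|->//].
  exact: val_inj.
rewrite fsbig1// => l [/size0nil l0]; rewrite /weight l0 /= => n0'.
by rewrite -n0' in n0.
Qed.

Lemma fsum_part_weight k n :
  \sum_(l \in [set l : intpart | size l = k /\ weight l = n]) part_weight l =
  fps_coef (part_gf k) n.
Proof.
have [N] := ubnP n; elim: N => // N IH in k n *; rewrite ltnS => nN.
(* For k = 0 the recursion does not lower the degree, so strong induction on [n] needs this case
   separately. *)
have [->|k0] := posnP k; first exact: fsum_part_weight0.
rewrite (reindex_fsbig _ _ _ _ (add_column_bij k n)) part_gf_rec coef_fpsXnM.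
case: leqP => kn; last first.
  by rewrite fsbig1// => l [_ ln]; move: kn; rewrite -ln ltnNge leq_addr.
have -> : [set l : intpart | (size l <= k)%N /\ (k + weight l)%N = n] =
          [set l : intpart | (size l <= k)%N /\ weight l = (n - k)%N].
  by apply/seteqP; split=> l /= [lk lw]; split=> //; lia.
rewrite fsum_size_le fps_coef_sum mulr_sumr; apply: eq_bigr => j _.
have jk : (j <= k)%N by rewrite -ltnS.
rewrite fps_coefZ -IH; last by lia.
rewrite !mulr_fsumr; apply: eq_fsbigr => l; rewrite inE => -[lj _].
by rewrite part_weight_add_column lj.
Qed.

End LocalWeights.

Theorem theorem4 (R : realType) (q u : R) (hq : 1 < q) (hu0 : 0 < u)
    (hu1 : u < 1) (k : nat) :
  fps_sum [set l : intpart | conj_part l 1 = k]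
    (fun l => Mmeas u q l *: fpsX ^+ weight l) =
  ((glorder k q)^-1 *: (u *: fpsX) ^+ k) *
  ((infprod u q)%:A / \prod_(1 <= r < k.+1) (1 - (u / q ^+ r) *: fpsX))
  :> fps R.
Proof.
have -> : \prod_(1 <= r < k.+1) (1 - (u / q ^+ r) *: fpsX) =
    qpoch_alg q^-1 (u *: fpsX : fps R) k.
  by apply: eq_bigr => r _; rewrite scalerA exprVn mulrC.
rewrite -[X in _ * X]scalerAl mul1r -scalerAr -scalerAl -/(part_gf u q k).
apply: fpsP => n; rewrite fps_coefZ -fsum_part_weight// mulr_fsumr.
transitivity (\sum_(l \in [set l : intpart | size l = k /\ weight l = n])
    fps_coef (Mmeas u q l *: fpsX ^+ weight l) n); last first.
  apply: eq_fsbigr => l; rewrite inE => -[_ ln].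
  by rewrite fps_coefZ fps_coefXn ln eqxx mulr1.
(* Partitions of weight other than n contribute zero to the coefficient of degree n, so the sum may
   be extended over all weights. *)
apply/esym/fsbig_widen => [l [lk _]|l [/= lk nl]]; first by rewrite /= conj_part1.
rewrite fps_coefXn; case: eqP => [ln|_]; last by rewrite mulr0.
by case: nl; rewrite -conj_part1.
Qed.
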